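(* Modified ordered resolution, with respect to a stable and enumerable ordering, together with splitting, $\mathcal{Q}$-splitting and ordered literal replacement, is sound and complete for any strategy. Precisely, let: - $S$ be a set of $\mathbb{P}$-clauses; - $<$ be a strict, stable and enumerable partial order on atoms; - $\mathcal{R}$ be a set of replacement rules that are ordered with respect to $<$; - $\mathcal{Q}$ be a finite set of splitting atoms; - $\phi$ be a $\mathcal{Q}$-splitting-replacement strategy. Then $S\cup cl(\mathcal{R})$ is unsatisfiable if and only if $S\Rrightarrow_{<_s,\phi,\mathcal{R}}^*\mathcal{T}$ for some closed tableau $\mathcal{T}$.
   Context: Basic notions. Clauses are finite sets of first-order literals, and satisfiability means having a Herbrand model. Fix a finite set $\mathbb{P}$ of predicate symbols; a $\mathbb{P}$-clause is a clause with predicates from $\mathbb{P}$. $C_1\sqcup C_2$ denotes $C_1\cup C_2$ where $C_1$, $C_2$ share no variables and $C_2\neq\emptyset$. Orderings. - A strict partial order $<$ on (non-splitting) atoms is stable if $A_1<A_2$ implies $A_1\sigma<A_2\sigma$ for every substitution $\sigma$. - It is enumerable if the ground atoms can be enumerated $A_1,A_2,\dots$ so that $A_i<A_j$ implies $i<j$. Splitting atoms. For each $\mathbb{P}$-clause $C$, taken modulo renaming, there is a fresh zero-ary predicate $\ulcorner C\urcorner$, called a splitting atom. Literals $\pm\ulcorner C\urcorner$ are splitting literals; all other atoms are non-splitting. Replacement rules. - A replacement rule is $A_1\rightarrow A_2$ with $A_1$, $A_2$ atoms containing no splitting symbols. Its associated clauses are $A_1\lor-A_2$ and $-A_1\lor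 A_2$, and $cl(\mathcal{R})$ is the union of these over $\mathcal{R}$. - The rule is ordered if $A_2<A_1$. - $S\rightarrow_{\mathcal{R}}(S\setminus\{\pm A_1\sigma\lor C\})\cup\{\pm A_2\sigma\lor C\}$ whenever $\pm A_1\sigma\lor C\in S$, $A_1\rightarrow A_2\in\mathcal{R}$ and $\sigma$ is a substitution. Tableaux and splitting. - A tableau is $S_1\mid\dots\mid S_n$ ($n\ge0$) of clause sets; it is closed if each branch contains the empty clause $\Box$. Relations on sets are extended to tableaux by acting on one branch. - Splitting: $\mathcal{T}\mid S\rightarrow_{spl}\mathcal{T}\mid(S\setminus\{C_1\sqcup C_2\})\cup\{C_1\}\mid(S\setminus\{C_1\sqcup C_2\})\cup\{C_2\}$ for $C_1\sqcup C_2\in S$ with $C_1$, $C_2$ non-empty. - $\mathcal{Q}$-splitting: $S\rightarrow_{\mathcal{Q}-nspl}(S\setminus\{C_1\sqcup C_2\})\cup\{C_1\lor-\ulcorner C_2\urcorner,\ \ulcorner C_2\urcorner\lor C_2\}$, where $C_1\sqcup C_2\in S$, $C_2$ is non-empty with only non-splitting literals, $C_1$ has at least one non-splitting literal, and $\ulcorner C_2\urcorner\in\mathcal{Q}$. Modified resolution. - The extended order $<_s$ sets $q<_sA$ for every splitting atom $q$ and non-splitting atom $A$, and $A<_sB$ iff $A<B$ for non-splitting $A$, $B$. A literal $\pm A$ is maximal in a clause $C$ if no $\pm'B\in C$ has $A<_sB$. - Modified ordered binary resolution derives $C_1\sigma\lor C_2\sigma$ from renamed-apart $C_1\lor A$ and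 $-B\lor C_2$, with $\sigma=\mathrm{mgu}(A,B)$, provided: (1) $C_1$ has no negative splitting literal and $A$ is maximal in $C_1\lor A$; and (2) either $B\in\mathcal{Q}$, or $C_2$ has no negative splitting literal and $B$ is maximal in $-B\lor C_2$. - Ordered factorization derives $C_1\sigma\lor\pm A\sigma$ from $C_1\lor\pm A\lor\pm B$, with $\sigma=\mathrm{mgu}(A,B)$ and $A$, $B$ maximal. - $S\Rrightarrow_{<_s}S\cup\{C\}$ if $C$ results from one such step on clauses of $S$. Strategy and overall relation. - A $\mathcal{Q}$-splitting-replacement strategy is a function $\phi$ on tableaux with $\mathcal{T}\,(\rightarrow_{\mathcal{Q}-nspl}\cup\rightarrow_{spl}\cup\rightarrow_{\mathcal{R}})^*\,\phi(\mathcal{T})$ for all tableaux $\mathcal{T}$. - $S\Rrightarrow_{<_s,\phi,\mathcal{R}}\phi(T)$ whenever $S\cup cl(\mathcal{R})\Rrightarrow_{<_s}T$. This is extended to tableaux by acting on one branch.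
   Formalization: In Q-splitting, C1 and C2 must share no literal, and in replacement the replaced literal must not occur in the rest C (with plain unions a strategy can block the empty clause forever); the signature is assumed to have a constant, so that the Herbrand universe is non-empty. *)

(* Defs.v *)
(* MathComp world, with MathComp's finmap and classical sets. *)
From Stdlib Require Export Relations.Relation_Operators.
From HB Require Import structures.
From mathcomp Require Export all_boot generic_quotient finmap.
From mathcomp Require Export boolp classical_sets.

Set Implicit Arguments.
Unset Strict Implicit.
Unset Printing Implicit Defensive.

Local Open Scope classical_set_scope.

Record signature := Signature {
  fsym : choiceType;
  farity : fsym -> nat;
  psym : finType;
  parity : psym -> nat
}.

Section Syntax.
Variable Sg : signature.

Local Unset Elimination Schemes.
Inductive term : Type :=
  | Var of nat
  | App (f : fsym Sg) of {ffun 'I_(farity f) -> term}.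

Lemma term_ind (K : term -> Prop) :
  (forall x, K (Var x)) ->
  (forall f (ts : {ffun 'I_(farity f) -> term}),
     (forall i, K (ts i)) -> K (App ts)) ->
  forall t, K t.
Proof.
move=> KV KA; fix IH 1; case=> [x|f ts]; first exact: KV.
by apply: KA => i; apply: IH.
Qed.

Fixpoint term_encode (t : term) : GenTree.tree (nat + fsym Sg) :=
  match t with
  | Var x => GenTree.Leaf (inl x)
  | App f ts => GenTree.Node 0
      (GenTree.Leaf (inr f) :: [seq term_encode (ts i) | i <- enum 'I_(farity f)])
  end.

Fixpoint term_decode (u : GenTree.tree (nat + fsym Sg)) : term :=
  match u with
  | GenTree.Leaf (inl x) => Var x
  | GenTree.Node _ (GenTree.Leaf (inr f) :: us) =>
      App [ffun i : 'I_(farity f) => nth (Var 0) (map term_decode us) i]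
  | _ => Var 0
  end.

Lemma term_encodeK : cancel term_encode term_decode.
Proof.
elim=> [x|f ts IH] //=; congr App; apply/ffunP => i; rewrite ffunE -map_comp.
by rewrite (nth_map i) ?size_enum_ord // nth_ord_enum /= IH.
Qed.

HB.instance Definition _ := Choice.copy term (can_type term_encodeK).

Fixpoint occurs (x : nat) (t : term) : bool :=
  match t with
  | Var y => x == y
  | App f ts => [exists i, occurs x (ts i)]
  end.

Definition subst := nat -> term.

Fixpoint tsubst (s : subst) (t : term) : term :=
  match t with
  | Var x => s x
  | App f ts => App [ffun i => tsubst s (ts i)]
  end.

Definition ground_subst (s : subst) : Prop := forall x y, ~~ occurs y (s x).

Definition renaming (s : subst) : Prop :=
  exists2 r : nat -> nat, bijective r & forall x, s x = Var (r x).

(* Non-splitting atoms. *)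
Definition patom : Type := {p : psym Sg & {ffun 'I_(parity p) -> term}}.
HB.instance Definition _ := Choice.on patom.

Definition poccurs (x : nat) (A : patom) : bool :=
  [exists i, occurs x (tagged A i)].

Definition pground (A : patom) : Prop := forall x, ~~ poccurs x A.

Definition psubst (s : subst) (A : patom) : patom :=
  Tagged (fun p : psym Sg => {ffun 'I_(parity p) -> term})
         [ffun i => tsubst s (tagged A i)].

(* In a literal [(b, A)] the sign [b] is [true] for [+A] and [false] for [-A]. *)
Definition pclause : Type := {fset bool * patom}.
HB.instance Definition _ := Choice.on pclause.

Definition pcsubst (s : subst) (C : pclause) : pclause :=
  [fset (l.1, psubst s l.2) | l in C]%fset.

Definition variant (C D : pclause) : bool :=
  `[< exists2 s : subst, renaming s & D = pcsubst s C >].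

Lemma tsubst_Var t : tsubst Var t = t.
Proof. by elim: t => [//|f ts IH] /=; congr App; apply/ffunP => i; rewrite ffunE. Qed.

Lemma tsubst_comp s1 s2 t :
  tsubst s2 (tsubst s1 t) = tsubst (fun x => tsubst s2 (s1 x)) t.
Proof.
elim: t => [//|f ts IH] /=; congr App; apply/ffunP => i; rewrite !ffunE.
exact: IH.
Qed.

Lemma psubst_Var A : psubst Var A = A.
Proof.
case: A => p ts; rewrite /psubst /=; congr Tagged; apply/ffunP => i.
by rewrite ffunE tsubst_Var.
Qed.

Lemma psubst_comp s1 s2 A :
  psubst s2 (psubst s1 A) = psubst (fun x => tsubst s2 (s1 x)) A.
Proof.
case: A => p ts; rewrite /psubst /=; congr Tagged; apply/ffunP => i.
by rewrite !ffunE tsubst_comp.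
Qed.

Lemma pcsubst_Var C : pcsubst Var C = C.
Proof.
apply/fsetP => l; apply/imfsetP/idP => [[m /= mC ->]|lC].
  by rewrite psubst_Var -surjective_pairing.
by exists l => //=; rewrite psubst_Var -surjective_pairing.
Qed.

Lemma pcsubst_comp s1 s2 C :
  pcsubst s2 (pcsubst s1 C) = pcsubst (fun x => tsubst s2 (s1 x)) C.
Proof.
apply/fsetP => l; apply/imfsetP/imfsetP => [[m /= /imfsetP[k /= kC ->] ->]|[k /= kC ->]].
  by exists k => //=; rewrite psubst_comp.
exists (k.1, psubst s1 k.2); last by rewrite /= psubst_comp.
by apply/imfsetP; exists k.
Qed.

Lemma variant_refl : reflexive variant.
Proof.
move=> C; apply/asboolP; exists Var; last by rewrite pcsubst_Var.
by exists id => //; exists id.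
Qed.

Lemma variant_sym : symmetric variant.
Proof.
suff H C D : variant C D -> variant D C by move=> C D; apply/idP/idP; apply: H.
move=> /asboolP[s [r [r' rK r'K] sr] ->]; apply/asboolP.
exists (fun x => Var (r' x)); first by exists r' => //; exists r.
rewrite pcsubst_comp (_ : (fun x => _) = Var) ?pcsubst_Var //.
by apply/funext => x; rewrite sr /= rK.
Qed.

Lemma variant_trans : transitive variant.
Proof.
move=> D C E /asboolP[s [r rb sr] ->] /asboolP[s' [r' r'b s'r'] ->].
apply/asboolP; exists (fun x => tsubst s' (s x)); last by rewrite pcsubst_comp.
exists (r' \o r); first exact: bij_comp.
by move=> x; rewrite sr /= s'r'.
Qed.

Canonical variant_equiv := EquivRel variant variant_refl variant_sym variant_trans.

Definition satom : Type := {eq_quot variant}%qT.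
HB.instance Definition _ := EqQuotient.on satom.
HB.instance Definition _ := Choice.on satom.

Definition satom_of (C : pclause) : satom := (\pi_satom C)%qT.

Definition atom : Type := (patom + satom)%type.
HB.instance Definition _ := Choice.on atom.
Definition literal : Type := (bool * atom)%type.
HB.instance Definition _ := Choice.on literal.
Definition clause : Type := {fset literal}.
HB.instance Definition _ := Choice.on clause.

Definition clause_of (C : pclause) : clause := [fset (l.1, inl l.2) | l in C]%fset.

Definition asubst (s : subst) (A : atom) : atom :=
  match A with inl A' => inl (psubst s A') | inr q => inr q end.

Definition csubst (s : subst) (C : clause) : clause :=
  [fset (l.1, asubst s l.2) | l in C]%fset.

Definition aoccurs (x : nat) (A : atom) : bool :=
  match A with inl A' => poccurs x A' | inr _ => false end.

Definition coccurs (x : nat) (C : clause) : Prop :=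
  exists2 l : literal, l \in C & aoccurs x l.2.

Definition var_disjoint (C D : clause) : Prop :=
  forall x, ~ (coccurs x C /\ coccurs x D).

(* Herbrand interpretations: sets of ground atoms. *)
Definition herbrand (H : set atom) : Prop := forall A x, H A -> ~~ aoccurs x A.

Definition satisfies (H : set atom) (C : clause) : Prop :=
  forall s, ground_subst s ->
    exists2 l, l \in csubst s C & (if l.1 then H l.2 else ~ H l.2).

Definition satisfiable (S : set clause) : Prop :=
  exists2 H, herbrand H & forall C, S C -> satisfies H C.

Definition strict_order (lt : patom -> patom -> Prop) : Prop :=
  (forall A, ~ lt A A) /\ (forall A B C, lt A B -> lt B C -> lt A C).

Definition stable (lt : patom -> patom -> Prop) : Prop :=
  forall s A B, lt A B -> lt (psubst s A) (psubst s B).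

(* The enumeration is partial, as there may be finitely many ground atoms. *)
Definition enumerable (lt : patom -> patom -> Prop) : Prop :=
  exists e : nat -> option patom,
    [/\ forall i A, e i = Some A -> pground A,
        forall A, pground A -> exists i, e i = Some A,
        forall i j A, e i = Some A -> e j = Some A -> i = j
      & forall i j A B, e i = Some A -> e j = Some B -> lt A B -> (i < j)%N].

(* The pair [(A1, A2)] is the rule [A1 -> A2]. *)
Definition rule : Type := (patom * patom)%type.

Definition ordered (lt : patom -> patom -> Prop) (R : set rule) : Prop :=
  forall A1 A2, R (A1, A2) -> lt A2 A1.

Definition cl (R : set rule) : set clause :=
  [set C | exists A1 A2, R (A1, A2) /\
     (C = [fset (true, inl A1); (false, inl A2)]%fset \/
      C = [fset (false, inl A1); (true, inl A2)]%fset)].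

(* [[:: S1; ...; Sn]] is the tableau [S1 | ... | Sn]. *)
Definition tableau : Type := seq (set clause).

Definition closed_tableau (T : tableau) : Prop :=
  forall i, (i < size T)%N -> nth set0 T i fset0.

Definition on_branch (step : set clause -> tableau -> Prop) (T T' : tableau) : Prop :=
  exists T1 S T2 U, [/\ T = T1 ++ S :: T2, step S U & T' = T1 ++ U ++ T2].

Definition spl (S : set clause) (U : tableau) : Prop :=
  exists C1 C2 : clause,
    [/\ S (C1 `|` C2)%fset, var_disjoint C1 C2, C1 != fset0, C2 != fset0
      & U = [:: (S `\ (C1 `|` C2)%fset) `|` [set C1];
                (S `\ (C1 `|` C2)%fset) `|` [set C2]]].

(* The two components must be disjoint as sets of literals: otherwise the
   ground clause [{A}] could be split into [{A, -q}] and [{q, A}]. *)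
Definition nspl (Q : {fset satom}) (S : set clause) (U : tableau) : Prop :=
  exists (C1 : clause) (D : pclause), let C2 := clause_of D in let q := satom_of D in
    [/\ S (C1 `|` C2)%fset,
        var_disjoint C1 C2 /\ [disjoint C1 & C2]%fset,
        D != fset0 /\ (exists b A, (b, inl A) \in C1),
        q \in Q
      & U = [:: (S `\ (C1 `|` C2)%fset) `|`
                  [set ((false, inr q) |` C1)%fset; ((true, inr q) |` C2)%fset]]].

(* [C] is the rest of the clause, so that the rewritten literal disappears. *)
Definition repl (R : set rule) (S : set clause) (U : tableau) : Prop :=
  exists (A1 A2 : patom) (s : subst) (b : bool) (C : clause),
    let L1 : literal := (b, inl (psubst s A1)) in
    let L2 : literal := (b, inl (psubst s A2)) in
    [/\ R (A1, A2), L1 \notin C, S (L1 |` C)%fset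
      & U = [:: (S `\ (L1 |` C)%fset) `|` [set (L2 |` C)%fset]]].

Definition strategy (Q : {fset satom}) (R : set rule) (phi : tableau -> tableau) : Prop :=
  forall T, clos_refl_trans tableau
    (fun T1 T2 => on_branch (nspl Q) T1 T2 \/ on_branch spl T1 T2
                  \/ on_branch (repl R) T1 T2) T (phi T).

Definition slt (lt : patom -> patom -> Prop) (A B : atom) : Prop :=
  match A, B with
  | inl A', inl B' => lt A' B'
  | inr _, inl _ => True
  | _, inr _ => False
  end.

Definition maximal (lt : patom -> patom -> Prop) (A : atom) (C : clause) : Prop :=
  forall l, l \in C -> ~ slt lt A l.2.

Definition no_neg_splitting (C : clause) : Prop := forall q, (false, inr q) \notin C.

Definition is_mgu (s : subst) (A B : atom) : Prop :=
  asubst s A = asubst s B /\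
  forall s', asubst s' A = asubst s' B ->
    exists d : subst, forall x, s' x = tsubst d (s x).

Definition resolvent (lt : patom -> patom -> Prop) (Q : {fset satom})
    (D1 D2 E : clause) : Prop :=
  exists (r1 r2 s : subst) (C1 C2 : clause) (A B : atom),
    let P1 := ((true, A) |` C1)%fset in
    let P2 := ((false, B) |` C2)%fset in
    [/\ [/\ renaming r1, renaming r2, csubst r1 D1 = P1, csubst r2 D2 = P2
          & var_disjoint P1 P2],
        is_mgu s A B,
        no_neg_splitting C1 /\ maximal lt A P1,
        (exists2 q, q \in Q & B = inr q) \/ (no_neg_splitting C2 /\ maximal lt B P2)
      & E = (csubst s C1 `|` csubst s C2)%fset].

Definition factor (lt : patom -> patom -> Prop) (D E : clause) : Prop :=
  exists (s : subst) (C : clause) (b : bool) (A B : atom),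
    [/\ D = ((b, A) |` ((b, B) |` C))%fset,
        is_mgu s A B,
        maximal lt A D /\ maximal lt B D
      & E = ((b, asubst s A) |` csubst s C)%fset].

Definition infer (lt : patom -> patom -> Prop) (Q : {fset satom})
    (S T : set clause) : Prop :=
  exists E, T = S `|` [set E] /\
    ((exists D1 D2, [/\ S D1, S D2 & resolvent lt Q D1 D2 E]) \/
     (exists2 D, S D & factor lt D E)).

Definition derive (lt : patom -> patom -> Prop) (Q : {fset satom}) (R : set rule)
    (phi : tableau -> tableau) : tableau -> tableau -> Prop :=
  on_branch (fun S U => exists2 T, infer lt Q (S `|` cl R) T & U = phi [:: T]).

End Syntax.

(* Main.v *)
(* Soundness: extend a Herbrand model so that a splitting atom is true exactly
   when its clause fails; every step then leaves a branch satisfied.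

   Completeness: fix a subset M of Q and consider the semantic tree over the
   enumerated ground atoms, above the truth assignment M of the splitting atoms.
   At a node where a clause fails, give the failure weight 0 if a clause of cl(R)
   is responsible, and otherwise the least weight of a failing clause, a
   non-splitting literal counting 2 and a negative splitting literal 1.  Splitting,
   Q-splitting and ordered replacement never increase the weight at any node.
   Conversely, a clause set without the empty clause admits an inference lowering
   some weight: choose M minimal among the sets meeting every clause made of
   positive splitting literals.  At a node above M whose children both fail, a
   responsible clause with a literal -q resolves with the clause that forces q to
   be in M, a clause with two literals on the last atom is factored, and otherwise
   resolution makes the node itself fail.  By unsatisfiability and the fan theorem
   finitely many nodes matter, so whatever the strategy does, iterating reaches the
   empty clause on every branch. *)
From Stdlib Require Import Eqdep_dec.
From Stdlib Require List.
Require Import Defs.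

Set Implicit Arguments.
Unset Strict Implicit.
Unset Printing Implicit Defensive.

Local Open Scope classical_set_scope.

(** * First-order terms and most general unifiers *)

Section Terms.
Variable Sg : signature.
Implicit Types (t u : term Sg) (s : subst Sg).

Lemma eq_tsubst s s' t :
  (forall x, occurs x t -> s x = s' x) -> tsubst s t = tsubst s' t.
Proof.
elim: t => [x|f ts IH] /= ss'; first by apply: ss'; rewrite eqxx.
congr App; apply/ffunP => i; rewrite !ffunE; apply: IH => x xi.
by apply: ss'; apply/existsP; exists i.
Qed.

Lemma occurs_tsubst y s t :
  occurs y (tsubst s t) -> exists2 x, occurs x t & occurs y (s x).
Proof.
elim: t => [x|f ts IH] /=; first by exists x.
case/existsP => i; rewrite ffunE => /IH[x xi yx].
by exists x => //; apply/existsP; exists i.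
Qed.

Lemma ground_tsubst s y t : ground_subst s -> ~~ occurs y (tsubst s t).
Proof. by move=> gs; apply/negP => /occurs_tsubst[x _]; apply/negP/gs. Qed.

Lemma tsubst_ground s t : (forall x, ~~ occurs x t) -> tsubst s t = t.
Proof.
by move=> gt; rewrite -[RHS]tsubst_Var; apply: eq_tsubst => x; rewrite (negPf (gt x)).
Qed.

Fixpoint tsize t : nat :=
  match t with
  | Var _ => 1
  | App f ts => (\sum_i tsize (ts i)).+1
  end.

Lemma tsize_gt0 t : 0 < tsize t. Proof. by case: t. Qed.

Lemma tsize_occurs s x t : occurs x t -> tsize (s x) <= tsize (tsubst s t).
Proof.
elim: t => [y|f ts IH] /=; first by move/eqP->.
case/existsP => i /IH; rewrite (bigD1 i) //= ffunE => le.
by apply: leq_trans le _; rewrite -addSn; apply: leq_trans (leq_addr _ _).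
Qed.

Lemma tsize_occurs_App s x (f : fsym Sg) ts :
  occurs x (App (f := f) ts) -> tsize (s x) < tsize (tsubst s (App ts)).
Proof.
case/existsP => i xi; rewrite /= ltnS (bigD1 i) //= ffunE.
by apply: leq_trans (leq_addr _ _); apply: tsize_occurs.
Qed.

Lemma App_inj (f : fsym Sg) (ts us : {ffun 'I_(farity f) -> term Sg}) :
  App ts = App us -> ts = us.
Proof. by case=> E; apply: inj_pair2_eq_dec E; apply: eq_comparable. Qed.

Definition unifies s (E : seq (term Sg * term Sg)) : Prop :=
  forall p, p \in E -> tsubst s p.1 = tsubst s p.2.

Definition bind x t : subst Sg := fun y => if y == x then t else Var Sg y.

Lemma tsubst_bind s x t u :
  s x = tsubst s t -> tsubst s (tsubst (bind x t) u) = tsubst s u.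
Proof.
move=> sx; rewrite tsubst_comp; apply: eq_tsubst => y _.
by rewrite /bind; case: eqP => [->|].
Qed.

(** Every unifier factors through [s] with itself as the mediating substitution. This idempotent
    form of most generality passes directly through variable elimination. *)
Definition idem_mgu s E : Prop :=
  unifies s E /\ forall s', unifies s' E -> forall x, s' x = tsubst s' (s x).

Lemma idem_mgu_bind x t E s :
  ~~ occurs x t ->
  idem_mgu s [seq (tsubst (bind x t) p.1, tsubst (bind x t) p.2) | p <- E] ->
  idem_mgu (fun y => tsubst s (bind x t y)) ((Var Sg x, t) :: E).
Proof.
move=> xt [sE sM].
have tt : tsubst (bind x t) t = t.
  rewrite -[RHS]tsubst_Var; apply: eq_tsubst => y yt; rewrite /bind.
  by case: eqP => // yx; rewrite yx (negPf xt) in yt.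
split=> [p|s' s'E y].
  rewrite inE => /predU1P[->|pE] /=; last first.
    rewrite -!tsubst_comp; apply: (sE (_, _)).
    by apply/mapP; exists p.
  by rewrite -tsubst_comp tt /bind eqxx.
have s'x : s' x = tsubst s' t by apply: (s'E (Var Sg x, t)); rewrite mem_head.
have /sM s'M : unifies s' [seq (tsubst (bind x t) p.1, tsubst (bind x t) p.2) | p <- E].
  move=> p /mapP[{}p pE ->] /=; rewrite !tsubst_bind //.
  by apply: s'E; rewrite inE pE orbT.
rewrite tsubst_comp -(eq_tsubst (s := s')) => [|z _]; last exact: s'M.
by rewrite /bind; case: eqP => [->|].
Qed.

Lemma eq_idem_mgu s E E' :
  (forall s', unifies s' E <-> unifies s' E') -> idem_mgu s E -> idem_mgu s E'.
Proof. by move=> EE' [sE sM]; split=> [|s' /EE']; [apply/EE'|apply: sM]. Qed.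

(* The induction measure is the size of the equations under the given unifier,
   which eliminating a variable preserves on the remaining equations. *)
Lemma unify s0 E : unifies s0 E -> exists s, idem_mgu s E.
Proof.
have [n] := ubnP (\sum_(p <- E) tsize (tsubst s0 p.1)).
elim: n E => // n IH [|[t u] E].
  by move=> _ _; exists (Var Sg); split.
rewrite big_cons /= ltnS => leN s0E.
have s0tu : tsubst s0 t = tsubst s0 u by apply: (s0E (t, u)); rewrite mem_head.
have s0E' : unifies s0 E by move=> p pE; apply: s0E; rewrite inE pE orbT.
have leE : \sum_(p <- E) tsize (tsubst s0 p.1) < n.
  by apply: leq_trans leN; rewrite -[ltnLHS]add0n ltn_add2r tsize_gt0.
have swap s t' u' : idem_mgu s ((t', u') :: E) -> idem_mgu s ((u', t') :: E).
  apply: eq_idem_mgu => s'; split=> s'E p; rewrite inE => /predU1P[->|pE] /=;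
    by [symmetry; apply: (s'E (_, _)); rewrite mem_head|apply: s'E; rewrite inE pE orbT].
have elimV x t' : s0 x = tsubst s0 t' -> exists s, idem_mgu s ((Var Sg x, t') :: E).
  move=> s0x; have [xt|xt] := boolP (occurs x t'); last first.
    have [||s sM] := IH [seq (tsubst (bind x t') p.1, tsubst (bind x t') p.2) | p <- E].
    - rewrite big_map /=; under eq_bigr do rewrite tsubst_bind //.
      exact: leE.
    - move=> p /mapP[{}p pE ->] /=; rewrite !tsubst_bind //; exact: s0E'.
    by exists (fun y => tsubst s (bind x t' y)); apply: idem_mgu_bind.
  (* Under [s0] a compound term containing [x] is strictly larger than [x], so the occurs check can
     only fail on the trivial equation between [x] and itself. *)
  case: t' => [y|f ts] in s0x xt *; last first.
    by have /(tsize_occurs_App s0) := xt; rewrite s0x ltnn.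
  move/eqP: xt => <-; have [s sM] := IH E leE s0E'.
  exists s; apply: eq_idem_mgu sM => s'; split=> s'E p; rewrite ?inE.
    by case/predU1P => [->|/s'E].
  by move=> pE; apply: s'E; rewrite inE pE orbT.
case: t => [x|f ts] in leN s0E s0tu swap *; first exact: elimV.
case: u => [x|g us] in leN s0E s0tu swap *.
  by have [s sM] := elimV x _ (esym s0tu); exists s; apply: swap.
have fg : f = g by case: s0tu.
case: g / fg us s0tu leN s0E swap => us s0tu leN s0E swap.
have [||s sM] := IH ([seq (ts i, us i) | i <- enum 'I_(farity f)] ++ E).
- rewrite big_cat /= big_map big_enum /=.
  apply: leq_trans leN; rewrite /= addSn ltnS leq_add2r.
  by under [leqRHS]eq_bigr do rewrite ffunE.
- move=> p; rewrite mem_cat => /orP[/mapP[i _ ->]|/s0E' //] /=.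
  by move/App_inj/ffunP: s0tu => /(_ i); rewrite !ffunE.
exists s; apply: eq_idem_mgu sM => s'; split=> s'E p.
  rewrite inE => /predU1P[->|pE]; last by apply: s'E; rewrite mem_cat pE orbT.
  rewrite /=; congr App; apply/ffunP => i; rewrite !ffunE.
  by apply: (s'E (_, _)); rewrite mem_cat map_f ?mem_enum.
rewrite mem_cat => /orP[/mapP[i _ ->]|pE]; last by apply: s'E; rewrite inE pE orbT.
have /App_inj/ffunP/(_ i) : tsubst s' (App ts) = tsubst s' (App us).
  by apply: (s'E (_, _)); rewrite mem_head.
by rewrite !ffunE.
Qed.

Lemma mgu_exists s0 (A B : patom Sg) :
  psubst s0 A = psubst s0 B -> exists s, is_mgu s (inl A) (inl B).
Proof.
case: A B => p ts [q us] eqs.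
have pq : p = q by case: (congr1 (@tag _ _) eqs).
case: q / pq us eqs => us eqs.
have arg s : psubst s (Tagged _ ts) = psubst s (Tagged _ us) <->
             unifies s [seq (ts i, us i) | i <- enum 'I_(parity p)].
  split=> [/= /eqP|sE].
    rewrite /psubst /= eq_Tagged /= => /eqP/ffunP E _ /mapP[i _ ->] /=.
    by move: (E i); rewrite !ffunE.
  rewrite /psubst /=; congr Tagged; apply/ffunP => i; rewrite !ffunE.
  by apply: (sE (_, _)); rewrite map_f ?mem_enum.
have /arg/unify[s [sE sM]] := eqs.
exists s; split=> [|s' /= []]; first by congr inl; apply/arg.
by move=> /arg s'E; exists s' => x; apply: sM.
Qed.

End Terms.

(** * Soundness *)

Section Soundness.
Variable Sg : signature.
Implicit Types (s t : subst Sg) (l : literal Sg) (C D E : clause Sg)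
  (H : set (atom Sg)) (S : set (clause Sg)) (T U : tableau Sg) (R : set (rule Sg))
  (lt : patom Sg -> patom Sg -> Prop) (Q : {fset satom Sg}).

Definition scomp s t : subst Sg := fun x => tsubst t (s x).

Lemma ground_scomp s t : ground_subst t -> ground_subst (scomp s t).
Proof. by move=> gt x y; apply: ground_tsubst. Qed.

Lemma eq_psubst s s' (A : patom Sg) :
  (forall x, poccurs x A -> s x = s' x) -> psubst s A = psubst s' A.
Proof.
case: A => p ts ss'; rewrite /psubst /=; congr Tagged; apply/ffunP => i.
by rewrite !ffunE; apply: eq_tsubst => x xi; apply: ss'; apply/existsP; exists i.
Qed.

Lemma ground_psubst s (A : patom Sg) : ground_subst s -> pground (psubst s A).
Proof.
by move=> gs x; rewrite negb_exists; apply/forallP => i; rewrite ffunE ground_tsubst.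
Qed.

Definition lsubst s l : literal Sg := (l.1, asubst s l.2).

Lemma lsubst_comp s t l : lsubst t (lsubst s l) = lsubst (scomp s t) l.
Proof. by case: l => b [A|q]; rewrite /lsubst //= psubst_comp. Qed.

Lemma eq_lsubst s s' l :
  (forall x, aoccurs x l.2 -> s x = s' x) -> lsubst s l = lsubst s' l.
Proof. by case: l => b [A|q] ss' //; congr (_, inl _); apply: eq_psubst. Qed.

Lemma mem_csubst s l C : l \in C -> lsubst s l \in csubst s C.
Proof. by move=> lC; apply/imfsetP; exists l. Qed.

Lemma csubstP s l C : l \in csubst s C -> exists2 m, m \in C & l = lsubst s m.
Proof. by case/imfsetP => m /= mC ->; exists m. Qed.

Lemma clause_ofP (D : pclause Sg) l : l \in clause_of D -> exists A, l.2 = inl A.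
Proof. by case/imfsetP => m /= _ ->; exists m.2. Qed.

Lemma clP R C : cl R C ->
  exists A1 A2 b, R (A1, A2) /\ C = [fset (b, inl A1); (~~ b, inl A2)]%fset.
Proof. by case=> A1 [A2 [RA [->|->]]]; exists A1, A2; [exists true|exists false]. Qed.

Lemma mem_cl R A1 A2 b :
  R (A1, A2) -> cl R [fset (b, inl A1); (~~ b, inl A2)]%fset.
Proof. by move=> RA; exists A1, A2; split=> //; case: b; [left|right]. Qed.

Definition holds H l : Prop := if l.1 then H l.2 else ~ H l.2.

Lemma satisfiesP H C : satisfies H C <->
  forall s, ground_subst s -> exists2 l, l \in C & holds H (lsubst s l).
Proof.
split=> sat s /sat[l lC hl]; last by exists (lsubst s l); first exact: mem_csubst.
by have [m mC ml] := csubstP lC; exists m; rewrite // -ml.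
Qed.

Lemma not_satisfies H C : ~ satisfies H C ->
  exists2 s, ground_subst s & forall l, l \in C -> ~ holds H (lsubst s l).
Proof.
move=> nsat; apply: contrapT => nex; apply/nsat/satisfiesP => s gs.
by apply: contrapT => nl; apply: nex; exists s => // l lC hl; apply: nl; exists l.
Qed.

Lemma satisfies_csubst H s C : satisfies H C -> satisfies H (csubst s C).
Proof.
move=> /satisfiesP sat; apply/satisfiesP => t /(ground_scomp s)/sat[l lC hl].
by exists (lsubst s l); [apply: mem_csubst|rewrite lsubst_comp].
Qed.

Lemma satisfies_sub H C D : (C `<=` D)%fset -> satisfies H C -> satisfies H D.
Proof.
move=> /fsubsetP sCD /satisfiesP sat; apply/satisfiesP => s /sat[l lC hl].
by exists l => //; apply: sCD.
Qed.

Lemma resolvent_sound H lt Q D1 D2 E :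
  resolvent lt Q D1 D2 E -> satisfies H D1 -> satisfies H D2 -> satisfies H E.
Proof.
case=> r1 [r2 [s [C1 [C2 [A [B [[_ _ E1 E2 _] [sAB _] _ _ ->]]]]]]].
move=> /(satisfies_csubst r1) + /(satisfies_csubst r2).
rewrite E1 E2 => /satisfiesP sat1 /satisfiesP sat2.
apply/satisfiesP => t /(ground_scomp s) gst.
have [l1 + hl1] := sat1 _ gst; have [l2 + hl2] := sat2 _ gst.
rewrite !inE => /predU1P[l2B|l2C]; last first.
  by exists (lsubst s l2); rewrite ?lsubst_comp // inE (mem_csubst _ l2C) orbT.
case/predU1P => [l1A|l1C]; last first.
  by exists (lsubst s l1); rewrite ?lsubst_comp // inE mem_csubst.
move: hl1 hl2; rewrite l1A l2B -!lsubst_comp /lsubst /holds /= sAB.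
by move=> hB /(_ hB).
Qed.

Lemma factor_sound H lt D E : factor lt D E -> satisfies H D -> satisfies H E.
Proof.
case=> s [C [b [A [B [-> [sAB _] _ ->]]]]] /(satisfies_csubst s).
apply: satisfies_sub; apply/fsubsetP => _ /csubstP[m + ->].
rewrite !inE => /predU1P[->|/predU1P[->|mC]].
- by rewrite -[lsubst _ _]/(b, asubst s A) eqxx.
- by rewrite -[lsubst _ _]/(b, asubst s B) -sAB eqxx.
- by rewrite mem_csubst ?orbT.
Qed.

Definition model H S : Prop := forall C, S C -> satisfies H C.

Lemma modelU H S S' : model H (S `|` S') <-> model H S /\ model H S'.
Proof.
split=> [m|[m m'] C [/m|/m'] //].
by split=> C SC; apply: m; [left|right].
Qed.

Lemma modelD H S S' : model H S -> model H (S `\` S').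
Proof. by move=> m C [/m]. Qed.

Lemma model1 H C : model H [set C] <-> satisfies H C.
Proof. by split=> [|m _ ->//]; apply. Qed.

(** Ground substitutions falsifying [C1] and [C2] separately glue to one falsifying the union, as no
    variable is shared. *)
Lemma satisfies_disjoint H C1 C2 : var_disjoint C1 C2 ->
  satisfies H (C1 `|` C2)%fset -> satisfies H C1 \/ satisfies H C2.
Proof.
move=> disj /satisfiesP sat; apply: contrapT => /not_orP[].
move=> /not_satisfies[s1 gs1 ns1] /not_satisfies[s2 gs2 ns2].
pose s x := if `[< coccurs x C1 >] then s1 x else s2 x.
have [|l] := sat s; first by move=> x y; rewrite /s; case: ifP.
rewrite inE => /orP[] lC hl; [apply: (ns1 l lC)|apply: (ns2 l lC)].
  rewrite (eq_lsubst (s' := s)) // => x xl; rewrite /s asboolT //.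
  by exists l.
rewrite (eq_lsubst (s' := s)) // => x xl; rewrite /s asboolF // => xC1.
by apply: (disj x); split=> //; exists l.
Qed.

(* A splitting atom asserts that its clause fails. *)
Definition splitting_model H : Prop := forall D : pclause Sg,
  H (inr (satom_of D)) <-> ~ satisfies H (clause_of D).

(** Splitting atoms are classes modulo renaming, hence the existential over representatives; by
    [satisfies_variant] the choice is immaterial. *)
Definition extend H : set (atom Sg) := [set A | match A with
  | inl _ => H A
  | inr q => exists2 D : pclause Sg, q = satom_of D & ~ satisfies H (clause_of D)
  end].

Lemma extend_satisfies H C : (forall l, l \in C -> exists A, l.2 = inl A) ->
  satisfies (extend H) C <-> satisfies H C.
Proof.
move=> nsC; have e s l : l \in C -> holds (extend H) (lsubst s l) <-> holds H (lsubst s l).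
  by move=> /nsC[A]; case: l => b ? /= ->; case: b.
by split=> /satisfiesP sat; apply/satisfiesP => s /sat[l lC /e hl]; exists l => //; apply: hl.
Qed.

Lemma satisfies_variant H (C D : pclause Sg) :
  variant C D -> satisfies H (clause_of C) -> satisfies H (clause_of D).
Proof.
move=> /asboolP[s _ ->] /(satisfies_csubst s).
apply: satisfies_sub; apply/fsubsetP => _ /csubstP[_ /imfsetP[l /= lC ->] ->].
by apply/imfsetP; exists (l.1, psubst s l.2) => //=; apply/imfsetP; exists l.
Qed.

Lemma extend_splitting_model H : splitting_model (extend H).
Proof.
move=> D; have e := extend_satisfies H (clause_ofP (D := D)).
split=> [[D' /eqP]|nD]; last by exists D => // /e.
rewrite eqmodE => /= DD' nD' /e sat; apply: nD'.
by apply: satisfies_variant sat.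
Qed.

Lemma spl_sound H S U : spl S U -> model H S -> List.Exists (model H) U.
Proof.
case=> C1 [C2 [SC disj _ _ ->]] m.
have [s|s] := satisfies_disjoint disj (m _ SC); [left|right; left];
  by apply/modelU; split; [apply: modelD|apply/model1].
Qed.

(** In a splitting model the atom of [D] is true exactly when its clause fails. So the clause
    defining it always holds, and when the atom is true the other component must hold. *)
Lemma nspl_sound H Q S U :
  splitting_model H -> nspl Q S U -> model H S -> List.Exists (model H) U.
Proof.
move=> sH [C1 [D [SC [disj _] _ _ ->]]] m; left.
apply/modelU; split; first exact: modelD.
have [s1|s2] := satisfies_disjoint disj (m _ SC); last first.
  have nq : ~ H (inr (satom_of D)) by move/sH.
  apply/modelU; split; apply/model1; last exact: satisfies_sub (fsubsetU1 _ _) s2.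
  by apply/satisfiesP => s _; exists (false, inr (satom_of D)); rewrite ?fset1U1.
apply/modelU; split; apply/model1; first exact: satisfies_sub (fsubsetU1 _ _) s1.
have [/sH nD|] := pselect (H (inr (satom_of D))).
  by apply/satisfiesP => s _; exists (true, inr (satom_of D)); rewrite ?fset1U1 //; apply/sH.
by move/sH/contrapT; apply: satisfies_sub (fsubsetU1 _ _).
Qed.

Lemma repl_sound H R S U :
  model H (cl R) -> repl R S U -> model H S -> List.Exists (model H) U.
Proof.
move=> mR [A1 [A2 [s [b [C [RA _ SC ->]]]]]] m; left.
apply/modelU; split; first exact: modelD.
apply/model1/satisfiesP => t gt.
have /satisfiesP/(_ t gt)[l] := m _ SC.
rewrite inE => /orP[|lC]; last by exists l; rewrite // inE lC orbT.
rewrite inE => /eqP-> {l} h1.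
have {}h1 : holds H (lsubst (scomp s t) (b, inl A1)) by rewrite -lsubst_comp.
(* Of the two clauses of the rule, the one where [A1] has the opposite sign carries truth over from
   the old literal to the new one. *)
have /satisfiesP/(_ _ (ground_scomp s gt))[l'] := mR _ (mem_cl (~~ b) RA).
rewrite !inE negbK => /orP[] /eqP-> h2.
  by move: h1 h2; rewrite /holds /=; case: b {RA SC} => // hA /(_ hA).
exists (b, inl (psubst s A2)); first by rewrite fset1U1.
by rewrite -[X in lsubst t X]/(lsubst s (b, inl A2)) lsubst_comp.
Qed.

Lemma on_branch_Exists (P : set (clause Sg) -> Prop) (st : set (clause Sg) -> tableau Sg -> Prop) :
  (forall S U, st S U -> P S -> List.Exists P U) ->
  forall T U, on_branch st T U -> List.Exists P T -> List.Exists P U.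
Proof.
move=> stP T U [T1 [S [T2 [V [-> SV ->]]]]].
move=> /List.Exists_app[?|/List.Exists_cons[PS|?]]; apply/List.Exists_app.
- by left.
- by right; apply/List.Exists_app; left; apply: stP SV PS.
- by right; apply/List.Exists_app; right.
Qed.

Lemma strategy_sound H Q R phi T : splitting_model H -> model H (cl R) ->
  strategy Q R phi -> List.Exists (model H) T -> List.Exists (model H) (phi T).
Proof.
move=> sH mR /(_ T); elim=> // [T1 T2|T1 T2 T3 _ IH1 _ IH2 /IH1/IH2//].
case=> [|[]]; apply: on_branch_Exists => S U; first exact: nspl_sound.
  exact: spl_sound.
exact: repl_sound.
Qed.

Lemma derive_sound H lt Q R phi T U : splitting_model H -> model H (cl R) ->
  strategy Q R phi -> clos_refl_trans _ (derive lt Q R phi) T U ->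
  List.Exists (model H) T -> List.Exists (model H) U.
Proof.
move=> sH mR st; elim=> // [T1 T2|T1 T2 T3 _ IH1 _ IH2 /IH1/IH2//].
apply: on_branch_Exists => S _ [S' [E [-> inf]] ->] mS.
apply: (strategy_sound sH mR st); left; apply/modelU.
have mSR : model H (S `|` cl R) by apply/modelU.
split=> //; apply/model1.
case: inf => [[D1 [D2 [/mSR m1 /mSR m2 res]]]|[D /mSR m fac]].
  exact: resolvent_sound res m1 m2.
exact: factor_sound fac m.
Qed.

(** The constant provides a ground substitution; without ground terms the empty clause would hold
    vacuously. *)
Lemma closed_no_model H T : (exists c : fsym Sg, farity c = 0) ->
  closed_tableau T -> ~ List.Exists (model H) T.
Proof.
move=> [c c0] + /List.Exists_nth[i [S [/ssrnat.ltP iT m]]] => /(_ i iT).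
have -> : nth set0 T i = List.nth i T S.
  by rewrite (set_nth_default S) //; elim: T i iT {m} => [|S' T IH] [|i] //=; apply: IH.
pose s : subst Sg := fun=> App [ffun _ : 'I_(farity c) => Var Sg 0].
have gs : ground_subst s.
  move=> x y; rewrite /= negb_exists; apply/forallP => k.
  by have := ltn_ord k; rewrite {2}c0.
by move=> Tbox; have /satisfiesP/(_ s gs)[] := m _ Tbox.
Qed.

Lemma derive_unsat lt Q R phi (S : set (pclause Sg)) T :
  (exists c : fsym Sg, farity c = 0) -> strategy Q R phi ->
  clos_refl_trans _ (derive lt Q R phi) [:: @clause_of Sg @` S] T ->
  closed_tableau T -> ~ satisfiable ((@clause_of Sg @` S) `|` cl R).
Proof.
move=> Hc st der clT [H _ mH].
(* The initial clauses contain no splitting atom, so extending the model does not affect them. *)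
have {mH}[mS mR] : model (extend H) (@clause_of Sg @` S) /\ model (extend H) (cl R).
  apply/modelU => C SC; apply/extend_satisfies; last exact: mH.
  case: SC => [[D _ <-]|/clP[A1 [A2 [b [_ ->]]]]] l; first exact: clause_ofP.
  by rewrite !inE => /orP[] /eqP->; [exists A1|exists A2].
apply: (closed_no_model (H := extend H) Hc clT).
by apply: (derive_sound (@extend_splitting_model H) mR st der); left.
Qed.

End Soundness.

(** * Combinatorics: fan theorem, minimal sets, induction on weights *)

Section Combinatorics.

Inductive bar (bad : seq bool -> Prop) (J : seq bool) : Prop :=
  | Bar_leaf of bad J
  | Bar_node of bar bad (rcons J false) & bar bad (rcons J true).

(** An unbarred node has an unbarred child; choosing one repeatedly would trace a path avoiding
    [bad]. So the root is barred, and induction on the bar yields a uniform depth. *)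
Lemma fan_theorem (bad : seq bool -> Prop) :
  (forall J b, bad J -> bad (rcons J b)) ->
  (forall f : nat -> bool, exists n, bad (mkseq f n)) ->
  exists d, forall J, d <= size J -> bad J.
Proof.
move=> badS badf; suff [d badd] : exists d, forall J', d <= size J' -> bad ([::] ++ J').
  by exists d.
have: bar bad [::].
  apply: contrapT => nbar.
  have /choice[g gP] J : exists b, ~ bar bad J -> ~ bar bad (rcons J b).
    have [bar0|] := pselect (bar bad (rcons J false)); last by exists false.
    by exists true => nJ bar1; apply/nJ/Bar_node.
  pose F n := iter n (fun J => rcons J (g J)) [::].
  have [n] := badf (fun n => g (F n)).
  have -> : mkseq (fun n => g (F n)) n = F n.
    by elim: n => // n IH; rewrite -{1}addn1 /mkseq iotaD map_cat -/(mkseq _ _) IH cats1.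
  have nb : ~ bar bad (F n) by elim: n => //= n /gP.
  by move=> bJ; apply/nb/Bar_leaf.
elim=> [J bJ|J _ [d0 b0] _ [d1 b1]].
  exists 0 => J' _; elim/last_ind: J' => [|J' b IH]; first by rewrite cats0.
  by rewrite -rcons_cat; apply: badS.
exists (maxn d0 d1).+1 => -[|b J'] //= ; rewrite ltnS geq_max -cat_rcons => /andP[le0 le1].
by case: b; [apply: b1|apply: b0].
Qed.

(** Otherwise each node that is not bad would have a child that is not bad, and such a branch would
    reach depth [d]. *)
Lemma last_open_node (bad : seq bool -> Prop) d :
  (forall J, d <= size J -> bad J) -> ~ bad [::] ->
  exists J, [/\ size J < d, ~ bad J & forall b, bad (rcons J b)].
Proof.
move=> badd nb; apply: contrapT => nex.
suff [J /eqP sJ nJ] : exists2 J, size J == d & ~ bad J by apply/nJ/badd; rewrite sJ.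
elim: {-2}d (leqnn d) => [|n IH] nd; first by exists [::].
have [J /eqP sJ nJ] := IH (ltnW nd).
apply: contrapT => nJb; apply: nex; exists J; split; rewrite ?sJ // => b.
by apply: contrapT => nb'; apply: nJb; exists (rcons J b); rewrite ?size_rcons ?sJ.
Qed.

Lemma seqs_upto d : exists X : seq (seq bool), forall J, size J <= d -> J \in X.
Proof.
elim: d => [|d [X XP]]; first by exists [:: [::]] => -[].
exists ([::] :: [seq b :: J | b <- [:: true; false], J <- X]) => -[|b J] // sJ.
by rewrite inE allpairs_f ?XP //; case: b {sJ}.
Qed.

Lemma fset_minimal (K : choiceType) (P : {fset K} -> Prop) (M0 : {fset K}) :
  P M0 -> exists M, [/\ (M `<=` M0)%fset, P M & forall q, q \in M -> ~ P (M `\ q)%fset].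
Proof.
have [n] := ubnP #|` M0|%fset; elim: n M0 => // n IH M0 ltn PM0.
have [[q qM Pq]|nex] := pselect (exists2 q, q \in M0 & P (M0 `\ q)%fset); last first.
  by exists M0; split=> // q qM Pq; apply: nex; exists q.
have [|M [sM PM minM]] := IH (M0 `\ q)%fset _ Pq.
  by move: ltn; rewrite (cardfsD1 q) qM.
by exists M; split=> //; apply: fsubset_trans sM (fsubD1set _ _).
Qed.

Lemma fset_bound (K : choiceType) (C : {fset K}) (P : K -> nat -> Prop) :
  (forall l, l \in C -> exists i, P l i) ->
  exists n, forall l, l \in C -> exists2 i, i < n & P l i.
Proof.
move=> ex; have /choice[g gP] l : exists i, l \in C -> P l i.
  by have [/ex[i]|] := boolP (l \in C); [exists i|exists 0].
exists (\max_(l <- C) g l).+1 => l lC; exists (g l); last exact: gP.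
by rewrite ltnS; apply: leq_bigmax_seq.
Qed.

Lemma ex_least (P : nat -> Prop) :
  (exists n, P n) -> exists2 n, P n & forall m, P m -> n <= m.
Proof.
case=> n Pn; have ex : exists n, `[< P n >] by exists n; apply/asboolP.
by case: (ex_minnP ex) => m /asboolP Pm mP; exists m => // k /asboolP/mP.
Qed.

Lemma ltn_sum_seq (I : eqType) (X : seq I) (f g : I -> nat) x :
  (forall y, y \in X -> f y <= g y) -> x \in X -> f x < g x ->
  \sum_(y <- X) f y < \sum_(y <- X) g y.
Proof.
move=> fg xX fgx; rewrite (big_rem x) // [ltnRHS](big_rem x) //= -addSn leq_add //.
rewrite big_seq [leqRHS]big_seq; apply: leq_sum => y /mem_rem; exact: fg.
Qed.

(* [W B x k] reads: the weight of [x] in [B] is at most [k]; it may be infinite. *)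
Lemma weight_ind (Br : Type) (I : eqType) (X : seq I) (W : Br -> I -> nat -> Prop)
    (P : Br -> Prop) :
  (forall B x k k', k <= k' -> W B x k -> W B x k') ->
  (forall B, (forall B', (forall x k, W B x k -> W B' x k) ->
                (exists x k, [/\ x \in X, W B' x k & ~ W B x k]) -> P B') -> P B) ->
  forall B, P B.
Proof.
move=> Wup IH; pose fin B x := `[< exists k, W B x k >].
have /choice[m mP] (p : Br * I) : exists n, fin p.1 p.2 ->
    W p.1 p.2 n /\ forall k, W p.1 p.2 k -> n <= k.
  have [/ex_least[n Wn le_n]|nW] := pselect (exists k, W p.1 p.2 k).
    by exists n => _; split.
  by exists 0 => /asboolP/nW.
have finW B x k : W B x k -> fin B x by move=> Wk; apply/asboolP; exists k.
have mW B x : fin B x -> W B x (m (B, x)) by move=> Bx; have [] := mP (B, x) Bx.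
have mle B x k : W B x k -> m (B, x) <= k.
  by move=> Wk; have [_] := mP (B, x) (finW _ _ _ Wk); apply.
(* The induction is lexicographic: first the number of points of [X] with infinite weight, then the
   sum of the finite weights. *)
pose inf B := \sum_(x <- X) ~~ fin B x.
pose tot B := \sum_(x <- X) if fin B x then m (B, x) else 0.
move=> B; have [a] := ubnP (inf B); elim: a B => // a IHa B.
have [b] := ubnP (tot B); elim: b B => // b IHb B totB infB.
apply: IH => B' BB' [x [k [xX W'x nWx]]].
have finBB' y : fin B y -> fin B' y by move=> /mW/BB'/finW.
have infle y : ~~ fin B' y <= ~~ fin B y.
  by have [/finBB'->//|_] := boolP (fin B y); apply: leq_b1.
(* Either some infinite weight becomes finite, or finiteness is unchanged on [X] and the weight of
   [x] drops. *)
have [[y [yX B'y By]]|infE] :=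
    pselect (exists y, [/\ y \in X, fin B' y & ~~ fin B y]).
  apply: IHa; apply: leq_trans (infB : inf B <= a).
  by apply: (ltn_sum_seq (x := y)) => //; rewrite B'y By.
apply: IHb; last first.
  by apply: leq_ltn_trans infB; apply: leq_sum => y _.
have finE y : y \in X -> fin B' y -> fin B y.
  by move=> yX B'y; apply: contrapT => /negP By; apply: infE; exists y.
have Bx : fin B x by apply: finE => //; apply: finW W'x.
apply: leq_trans (totB : tot B <= b); apply: (ltn_sum_seq (x := x)) => // [y yX|].
  have [By|By] := boolP (fin B y); first by rewrite finBB' //; apply/mle/BB'/mW.
  by case: ifP => // /finE-/(_ yX); rewrite (negPf By).
have B'x : fin B' x := finBB' _ Bx.
rewrite Bx B'x ltnNge; apply/negP => le; apply: nWx.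
exact: Wup (leq_trans le (mle _ _ _ W'x)) (mW _ _ Bx).
Qed.

End Combinatorics.

(** * Weights of clauses *)

Section Weights.
Variable Sg : signature.
Implicit Types (l : literal Sg) (C D : clause Sg).

(* The splitting literals weigh less, so that Q-splitting does not increase the weight. *)
Definition lweight l : nat := if l.2 is inl _ then 2 else ~~ l.1.

Definition weight C : nat := \sum_(l <- C) lweight l.

Lemma weightU1 l C : l \notin C -> weight (l |` C)%fset = lweight l + weight C.
Proof. exact: big_fsetU1. Qed.

Lemma weightD1 l C : l \in C -> weight C = lweight l + weight (C `\ l)%fset.
Proof. by move=> lC; rewrite -{1}(fsetD1K lC) weightU1 // !inE eqxx. Qed.

Lemma leq_weightU1 l C : weight (l |` C)%fset <= lweight l + weight C.
Proof.
have [lC|lC] := boolP (l \in C); last by rewrite weightU1.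
by rewrite (fsetUidPr _ _ _) ?leq_addl // fsub1set.
Qed.

Lemma weightUD C D : weight (C `|` D)%fset = weight C + weight (D `\` C)%fset.
Proof.
rewrite /weight -big_cat; apply/perm_big/uniq_perm => [||l]; first exact: fset_uniq.
  rewrite cat_uniq !fset_uniq andbT; apply/hasPn => l.
  by rewrite inE => /andP[].
by rewrite mem_cat !inE; case: (l \in C).
Qed.

Lemma weightU C D : [disjoint C & D]%fset -> weight (C `|` D)%fset = weight C + weight D.
Proof.
by move=> CD; rewrite weightUD; congr (_ + weight _); apply/fsetDidPl; rewrite fdisjoint_sym.
Qed.

Lemma weight_sub C D : (C `<=` D)%fset -> weight C <= weight D.
Proof. by move=> /fsetUidPr <-; rewrite weightUD leq_addr. Qed.

Lemma leq_weightU C D : weight (C `|` D)%fset <= weight C + weight D.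
Proof. by rewrite weightUD leq_add2l; apply/weight_sub/fsubsetDl. Qed.

Lemma csubstU1 s l C : csubst s (l |` C)%fset = (lsubst s l |` csubst s C)%fset.
Proof. by rewrite /csubst imfsetU1. Qed.

(** Only an inequality, as a substitution may merge literals. *)
Lemma weight_csubst s C : weight (csubst s C) <= weight C.
Proof.
elim/finSet_rect: C => C IH; have [->|[l lC]] := fset_0Vmem C.
  by rewrite /csubst imfset0.
rewrite -(fsetD1K lC) csubstU1 [leqRHS]weightU1 ?inE ?eqxx //.
apply: leq_trans (leq_weightU1 _ _) _; apply: leq_add; first by case: l {lC} => b [].
exact/IH/fproperD1.
Qed.

End Weights.

(** * Renaming clauses apart *)

Section Renaming.
Variable Sg : signature.
Implicit Types (s t r : subst Sg) (l : literal Sg) (C D : clause Sg).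

Fixpoint tbound (t : term Sg) : nat :=
  match t with
  | Var x => x.+1
  | App f ts => \max_i tbound (ts i)
  end.

Lemma occurs_tbound x (t : term Sg) : occurs x t -> x < tbound t.
Proof.
elim: t => [y /eqP->//|f ts IH] /= /existsP[i /IH]; move=> /leq_trans; apply.
exact: (leq_bigmax i).
Qed.

Lemma variables_bounded C : exists n, forall l x, l \in C -> aoccurs x l.2 -> x < n.
Proof.
have [|n nP] := fset_bound (C := C) (P := fun l n => forall x, aoccurs x l.2 -> x < n).
  case=> b [A|q] _; last by exists 0.
  exists (\max_i tbound (tagged A i)) => x /existsP[i /occurs_tbound /leq_trans]; apply.
  exact: (leq_bigmax i).
by exists n => l x /nP[i ni iP] /iP /ltn_trans; apply.
Qed.

(** A shift by [n] would not be surjective, whereas a renaming must be a bijection of the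
    variables. *)
Definition swap_blocks n x := if x < n then x + n else if x < n + n then x - n else x.

Lemma swap_blocksK n : involutive (swap_blocks n).
Proof.
move=> x; rewrite /swap_blocks; case: (ltnP x n) => [xn|nx].
  by rewrite ltnNge leq_addl /= ltn_add2r xn addnK.
case: (ltnP x (n + n)) => [xn|nnx]; last by rewrite ltnNge nx /= ltnNge nnx.
by rewrite ltn_subLR // xn subnK.
Qed.

(** A single ground substitution [t] comes to play the roles of [s1] and [s2], as lifting a ground
    resolution step requires. *)
Lemma rename_apart D1 D2 s1 s2 : ground_subst s1 -> ground_subst s2 ->
  exists r t, [/\ renaming r, var_disjoint D1 (csubst r D2), ground_subst t,
    forall l, l \in D1 -> lsubst t l = lsubst s1 l
    & forall l, l \in D2 -> lsubst t (lsubst r l) = lsubst s2 l].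
Proof.
move=> gs1 gs2; have [n nP] := variables_bounded (D1 `|` D2)%fset.
have n1 l x : l \in D1 -> aoccurs x l.2 -> x < n by move=> lD; apply: nP; rewrite inE lD.
have n2 l x : l \in D2 -> aoccurs x l.2 -> x < n by move=> lD; apply: nP; rewrite inE lD orbT.
exists (fun x => Var Sg (swap_blocks n x)).
exists (fun x => if x < n then s1 x else s2 (swap_blocks n x)); split.
- exists (swap_blocks n) => //; exists (swap_blocks n); exact: swap_blocksK.
- move=> x [[l lD1 /(n1 l x lD1) xn] [_ /csubstP[[c [A|q]] lD2 ->]]] //.
  case/existsP => i; rewrite ffunE => /occurs_tsubst[y yA /eqP xy].
  have yn : y < n by apply: (n2 _ _ lD2); apply/existsP; exists i.
  by move: xn; rewrite xy /swap_blocks yn ltnNge leq_addl.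
- by move=> x y; case: ifP.
- by move=> l lD; apply: eq_lsubst => x /(n1 l x lD)->.
- move=> l lD; rewrite lsubst_comp; apply: eq_lsubst => x /(n2 l x lD) xn.
  by rewrite /scomp /= {1}/swap_blocks xn ltnNge leq_addl /= swap_blocksK.
Qed.

End Renaming.

(** * The semantic tree: failing clauses and their weights *)

Section Falsification.
Variables (Sg : signature) (lt : patom Sg -> patom Sg -> Prop)
  (e : nat -> option (patom Sg)) (Q : {fset satom Sg}) (R : set (rule Sg)).
Implicit Types (s t : subst Sg) (l : literal Sg) (C D E : clause Sg)
  (S : set (clause Sg)) (T U : tableau Sg) (J : seq bool).

(* A node [(M, J)] makes true the splitting atoms of [M] and no other in [Q], and gives
   the [i]-th enumerated ground atom, for [i < size J], the value [nth false J i]. *)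
Definition node : Type := ({fset satom Sg} * seq bool)%type.
Implicit Types x : node.

(** The assignment is partial: splitting atoms outside [Q] and ground atoms beyond the depth of the
    node have no value, so neither literal on them is false. *)
Definition lfalse x l : Prop := match l.2 with
  | inl A => exists2 i, i < size x.2 & e i = Some A /\ nth false x.2 i = ~~ l.1
  | inr q => q \in Q /\ (q \in x.1) = ~~ l.1
  end.

Definition falsifies x s C : Prop := forall l, l \in C -> lfalse x (lsubst s l).

Definition fails x C : Prop := exists2 s, ground_subst s & falsifies x s C.

(** The strict bound reserves [k = 0] for failures due to [cl R]; a failing clause of [S] counts for
    its weight plus one. *)
Definition wfails S x k : Prop :=
  (exists2 C, cl R C & fails x C) \/ exists C, [/\ S C, fails x C & weight C < k].

Definition refines S S' : Prop := forall x k, wfails S x k -> wfails S' x k.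

Lemma wfails_leq S x k k' : k <= k' -> wfails S x k -> wfails S x k'.
Proof.
by move=> kk' [clf|[C [SC fC Ck]]]; [left|right; exists C; split=> //; apply: leq_trans kk'].
Qed.

Lemma wfails_sub S S' x k : (forall C, S C -> S' C) -> wfails S x k -> wfails S' x k.
Proof. by move=> SS' [clf|[C [SC fC Ck]]]; [left|right; exists C; split=> //; apply: SS']. Qed.

(** In the second case [C] is a lightest failing clause, and no clause of [cl R] fails. *)
Lemma wfails_least S x k : wfails S x k ->
  (exists2 C, cl R C & fails x C) \/
  exists C, [/\ S C, fails x C & ~ wfails S x (weight C)].
Proof.
move=> Wk; have [clf|nclf] := pselect (exists2 C, cl R C & fails x C); first by left.
right; have [//|n] := ex_least (P := fun n => exists C, [/\ S C, fails x C & weight C = n]).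
  by case: Wk => // -[C [SC fC _]]; exists (weight C), C.
move=> [C [SC fC wC]] nle; exists C; split=> // -[//|[C' [SC' fC' C'C]]].
by move: C'C; rewrite wC ltnNge nle //; exists C'.
Qed.

Lemma falsifies_sub x s C D : (C `<=` D)%fset -> falsifies x s D -> falsifies x s C.
Proof. by move=> /fsubsetP CD fD l /CD/fD. Qed.

Lemma falsifiesU x s C D : falsifies x s C -> falsifies x s D -> falsifies x s (C `|` D)%fset.
Proof. by move=> fC fD l; rewrite inE => /orP[/fC|/fD]. Qed.

Lemma falsifies1 x s l : lfalse x (lsubst s l) -> falsifies x s [fset l]%fset.
Proof. by move=> fl m; rewrite inE => /eqP->. Qed.

Lemma refines_replace S D V :
  (forall x, fails x D -> (exists2 C, cl R C & fails x C) \/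
     exists C, [/\ V C, fails x C & weight C <= weight D]) ->
  refines S ((S `\ D) `|` V).
Proof.
move=> DV x k [clf|[C [SC fC Ck]]]; first by left.
have [CD|CD] := pselect (C = D); last by right; exists C; split=> //; left; split.
rewrite CD in fC Ck; have [clf|[C' [VC' fC' C'D]]] := DV x fC; first by left.
by right; exists C'; split; [right| |apply: leq_ltn_trans Ck].
Qed.

(** A subclause fails wherever the clause does, and is no heavier. *)
Lemma spl_refines S U : spl S U -> List.Forall (refines S) U.
Proof.
case=> C1 [C2 [_ _ _ _ ->]].
apply: List.Forall_cons; last apply: List.Forall_cons => //; apply: refines_replace => x [s gs fs];
  right; [exists C1|exists C2]; split=> //.
- by exists s => //; apply: falsifies_sub fs; apply: fsubsetUl.
- exact/weight_sub/fsubsetUl.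
- by exists s => //; apply: falsifies_sub fs; apply: fsubsetUr.
- exact/weight_sub/fsubsetUr.
Qed.

(** The value of the splitting atom at the node decides which new clause fails. The negative
    splitting literal costs 1, less than the weight 2 of a literal of the removed component; the
    positive one costs nothing. *)
Lemma nspl_refines S U : nspl Q S U -> List.Forall (refines S) U.
Proof.
case=> C1 [D [_ [_ disj] [/fset0Pn[l lD] [b [A C1A]]] qQ ->]].
apply: List.Forall_cons => //; apply: refines_replace => x [s gs fs]; right.
have [qx|qx] := boolP (satom_of D \in x.1).
  exists (((false, inr (satom_of D)) |` C1)%fset); split; first by left.
    exists s => //; apply: falsifiesU; first by apply: falsifies1; split; rewrite ?qx.
    exact: falsifies_sub (fsubsetUl _ _) fs.
  rewrite weightU // (leq_trans (leq_weightU1 _ _)) // addnC leq_add2l.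
  rewrite (weightD1 (l := (l.1, inl l.2))) //.
  by apply/imfsetP; exists l.
exists (((true, inr (satom_of D)) |` clause_of D)%fset); split; first by right.
  exists s => //; apply: falsifiesU; first by apply: falsifies1; split; rewrite ?(negPf qx).
  exact: falsifies_sub (fsubsetUr _ _) fs.
by rewrite weightU // (leq_trans (leq_weightU1 _ _)) // leq_addl.
Qed.

Hypothesis lt_stable : stable lt.
Hypothesis e_onto : forall A, pground A -> exists i, e i = Some A.
Hypothesis e_mono : forall i j A B, e i = Some A -> e j = Some B -> lt A B -> (i < j)%N.
Hypothesis R_ordered : ordered lt R.

(** The instance of [A2] is enumerated before that of [A1], so the node gives it a value too. If the
    values agree, the rewritten clause fails and is no heavier; if they differ, a clause of [cl R]
    fails. *)
Lemma repl_refines S U : repl R S U -> List.Forall (refines S) U.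
Proof.
case=> A1 [A2 [s [b [C [RA L1C _ ->]]]]].
apply: List.Forall_cons => //; apply: refines_replace => x [t gt ft].
set L1 : literal Sg := (b, _) in L1C ft *; set L2 : literal Sg := (b, _).
have fC : falsifies x t C by apply: falsifies_sub (fsubsetU1 _ _) ft.
have /= [i ix [ei xi]] := ft L1 (fset1U1 _ _).
have [j ej] := e_onto (ground_psubst (psubst s A2) gt).
have ji : j < i by apply: e_mono ej ei _; do 2!apply: lt_stable; apply: R_ordered.
have [xj|xj] := eqVneq (nth false x.2 j) (~~ b).
  right; exists (L2 |` C)%fset; split; first exact: erefl.
    exists t; first exact: gt.
    apply: falsifiesU; last exact: fC.
    by apply: falsifies1; exists j; first exact: ltn_trans ji ix.
  by rewrite (weightU1 L1C); apply: leq_weightU1.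
left; exists [fset (b, inl A1); (~~ b, inl A2)]%fset; first exact: mem_cl.
exists (scomp s t); first exact: ground_scomp.
apply: falsifiesU; apply: falsifies1; rewrite -lsubst_comp.
  by exists i.
exists j; first exact: ltn_trans ji ix.
by split=> //=; case: (nth _ _ _) xj; case: b {RA L1C ft L1 L2 xi}.
Qed.

Lemma on_branch_Forall (P : set (clause Sg) -> Prop) (st : set (clause Sg) -> tableau Sg -> Prop) :
  (forall S U, st S U -> P S -> List.Forall P U) ->
  forall T U, on_branch st T U -> List.Forall P T -> List.Forall P U.
Proof.
move=> stP T U [T1 [S [T2 [V [-> SV ->]]]]].
move=> /List.Forall_app[P1 /List.Forall_cons_iff[PS P2]].
by apply/List.Forall_app; split=> //; apply/List.Forall_app; split=> //; apply: stP SV PS.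
Qed.

Lemma strategy_refines phi S T :
  strategy Q R phi -> List.Forall (refines S) T -> List.Forall (refines S) (phi T).
Proof.
move=> /(_ T); elim=> // [T1 T2|T1 T2 T3 _ IH1 _ IH2 /IH1/IH2//].
have step (st : set (clause Sg) -> tableau Sg -> Prop) :
    (forall S' U, st S' U -> List.Forall (refines S') U) ->
    on_branch st T1 T2 -> List.Forall (refines S) T1 -> List.Forall (refines S) T2.
  move=> stP; apply: on_branch_Forall => S' U /stP + SS'.
  by apply: List.Forall_impl => S'' S'S'' x k /SS'/S'S''.
case=> [|[]]; apply: step; [exact: nspl_refines|exact: spl_refines|exact: repl_refines].
Qed.

(** * Inferences that lower a weight *)

Definition inferable S E : Prop :=
  (exists D1 D2, [/\ S D1, S D2 & resolvent lt Q D1 D2 E]) \/ (exists2 D, S D & factor lt D E).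

(** Adding [E] strictly lowers the weight at [x], possibly from infinity. *)
Definition improvable S x : Prop := exists E,
  [/\ inferable (S `|` cl R) E, fails x E & ~ wfails S x (weight E).+1].

Lemma improvable_lt S x D E : inferable (S `|` cl R) E -> fails x E ->
  ~ wfails S x (weight D) -> weight E < weight D -> improvable S x.
Proof. by move=> inf fE nW ED; exists E; split=> // /(wfails_leq ED). Qed.

Definition positive_splitting S C : Prop :=
  S C /\ forall l, l \in C -> exists2 q, q \in Q & l = (true, inr q).

Definition hits S (M : {fset satom Sg}) : Prop :=
  forall C, positive_splitting S C -> exists2 q, q \in M & (true, inr q) \in C.

(** Each atom of [M] is forced by a clause that [M] hits nowhere else; this clause serves to resolve
    away the negative literal on that atom. *)
Definition supported S (M : {fset satom Sg}) : Prop :=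
  forall q, q \in M -> exists C, [/\ positive_splitting S C, (true, inr q) \in C &
    forall q', q' \in M -> (true, inr q') \in C -> q' = q].

(** [Q] hits every positive splitting clause, none being empty. In a minimal hitting set, removing
    [q] leaves some clause unhit, and that clause supports [q]. *)
Lemma minimal_hits S : ~ S fset0 -> exists M, [/\ (M `<=` Q)%fset, hits S M & supported S M].
Proof.
move=> S0; have [C [SC Cpos]|M [MQ hM minM]] := fset_minimal (P := hits S) (M0 := Q).
  have [C0|[l lC]] := fset_0Vmem C; first by rewrite C0 in SC.
  by have [q qQ ql] := Cpos l lC; exists q; rewrite // -ql.
exists M; split=> // q qM; apply: contrapT => nex; apply: (minM q qM) => C posC.
have [q' q'M q'C] := hM C posC; have [q'q|q'q] := eqVneq q' q; last by exists q'; rewrite // !inE q'q.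
apply: contrapT => nex'; apply: nex; exists C; split=> //; first by rewrite -q'q.
move=> q2 q2M q2C; apply: contrapT => /eqP q2q.
by apply: nex'; exists q2; rewrite // !inE q2q.
Qed.

Lemma csubst_Var C : csubst (@Var Sg) C = C.
Proof.
have idl l : lsubst (@Var Sg) l = l by case: l => b [A|q]; rewrite /lsubst //= psubst_Var.
apply/fsetP => l; apply/idP/idP => [/csubstP[m mC ->]|lC]; first by rewrite idl.
by rewrite -[l]idl mem_csubst.
Qed.

Lemma renaming_Var : renaming (@Var Sg).
Proof. by exists id => //; exists id. Qed.

(** The clause supporting [q] weighs 0 and its other literals are false at [M], so resolving with it
    just removes the literal of weight 1 from [D]. Membership of [q] in [Q] exempts [D] from the
    maximality condition. *)
Lemma resolve_splitting S M J D q : supported S M -> (S `|` cl R) D -> fails (M, J) D ->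
  (false, inr q) \in D ->
  exists E, [/\ inferable (S `|` cl R) E, fails (M, J) E & weight E < weight D].
Proof.
move=> supM SD [s gs fD] qD; have [qQ /= qM] := fD _ qD.
have [C [[SC Cpos] qC Cq]] := supM q qM.
set C' := (C `\ (true, inr q))%fset; set D' := (D `\ (false, inr q))%fset.
exists (C' `|` D')%fset; split.
- left; exists C, D; split=> //; first by left.
  exists (@Var Sg), (@Var Sg), (@Var Sg), C', D', (inr q), (inr q).
  rewrite !csubst_Var !fsetD1K //; split=> //.
  + split=> //; try exact: renaming_Var.
    by move=> x [[l /Cpos[q' _ ->]]].
  + by split=> // s' _; exists s' => x.
  + split=> [q'|l /Cpos[q' _ ->] //].
    by apply/negP; rewrite inE => /andP[_ /Cpos[]].
  + by left; exists q.
- exists s => //; apply: falsifiesU; last exact: falsifies_sub (fsubD1set _ _) fD.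
  move=> l; rewrite inE => /andP[lq lC]; have [q' q'Q lE] := Cpos l lC.
  rewrite lE in lq lC *; split=> //=; apply/negP => q'M.
  by move: lq; rewrite inE (Cq q') ?eqxx.
- rewrite (weightD1 qD) -/D' add1n ltnS (leq_trans (leq_weightU _ _)) //.
  suff -> : weight C' = 0 by [].
  rewrite /weight big_seq big1 // => l; rewrite inE => /andP[_ /Cpos[q' _ ->]].
  by [].
Qed.

(** The mediating substitution need not be ground, but following it by [t] makes it so without
    changing the instances, already ground. *)
Lemma is_mgu_ground s t (A B : atom Sg) : is_mgu s A B -> ground_subst t ->
  asubst t A = asubst t B ->
  exists2 d, ground_subst d & forall l, lsubst d (lsubst s l) = lsubst t l.
Proof.
move=> [_ mgu] gt /mgu[d td]; exists (scomp d t) => [|l]; first exact: ground_scomp.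
rewrite lsubst_comp; apply: eq_lsubst => x _.
rewrite /scomp -(tsubst_comp d t) -td tsubst_ground //.
Qed.

Lemma lfalse_rcons M J b l : lfalse (M, rcons J b) l ->
  lfalse (M, J) l \/ exists2 A, e (size J) = Some A & l = (~~ b, inl A).
Proof.
case: l => c [A [i]|q] /=; last by left.
rewrite size_rcons ltnS nth_rcons => iJ [ei].
case: (ltngtP i (size J)) iJ => // [iJ _|iE _] bc; first by left; exists i.
by right; exists A; rewrite ?bc ?negbK // -iE.
Qed.

(** By stability a larger atom of [C] would have an instance enumerated after [A], to which the node
    gives no value. *)
Lemma maximal_last M J b s C l A : falsifies (M, rcons J b) s C -> l \in C ->
  e (size J) = Some A -> (lsubst s l).2 = inl A -> maximal lt l.2 C.
Proof.
move=> fC lC eJ lA m mC; have := fC m mC.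
case: l lC lA => c [B|q] lC //= [BA]; case: m mC => c' [B'|q'] mC; last by move=> _ [].
move=> /= [i].
rewrite size_rcons ltnS => iJ [ei _] /(lt_stable s).
by rewrite BA => /(e_mono eJ ei); rewrite ltnNge iJ.
Qed.

(** Both literals are maximal, lying on the last atom, and merging them saves weight 2. *)
Lemma factor_step S M J b s D (l m : literal Sg) A :
  S D -> ground_subst s -> falsifies (M, rcons J b) s D ->
  e (size J) = Some A -> l \in D -> m \in D -> m != l ->
  lsubst s l = (~~ b, inl A) -> lsubst s m = (~~ b, inl A) ->
  exists E, [/\ inferable S E, fails (M, rcons J b) E & weight E < weight D].
Proof.
move=> SD gs fD eJ lD mD ml sl sm.
have lmax : maximal lt l.2 D by apply: maximal_last fD lD eJ _; rewrite sl.
have mmax : maximal lt m.2 D by apply: maximal_last fD mD eJ _; rewrite sm.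
case: l m => [c [B|q]] [c' [B'|q']] // in lD mD ml sl sm lmax mmax.
case: sl sm => cb BA [c'b B'A]; rewrite {}c'b -{}cb in mD ml.
have BB' : psubst s B = psubst s B' by rewrite BA.
have [u mgu] := mgu_exists BB'.
set C := (D `\ (c, inl B) `\ (c, inl B'))%fset.
have m'D : (c, inl B') \in (D `\ (c, inl B))%fset by rewrite !inE ml.
have DE : D = ((c, inl B) |` ((c, inl B') |` C))%fset by rewrite !fsetD1K.
exists ((c, asubst u (inl B)) |` csubst u C)%fset; split.
- by right; exists D => //; exists u, C, c, (inl B), (inl B').
- have [d gd dP] := is_mgu_ground mgu gs (congr1 inl BB'); exists d => //.
  have -> : ((c, asubst u (inl B)) |` csubst u C)%fset = csubst u ((c, inl B) |` C)%fset.
    by rewrite csubstU1.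
  move=> _ /csubstP[k kC ->]; rewrite dP; apply: fD.
  by rewrite DE; move: kC; rewrite !in_fset1U => /orP[->|->]; rewrite ?orbT.
- rewrite (weightD1 lD) (weightD1 m'D) -/C.
  apply: leq_ltn_trans (leq_weightU1 _ _) _.
  by rewrite /lweight /= ltn_add2l add2n ltnS leqW ?weight_csubst.
Qed.

(** Hence a clause of [cl R] never needs factoring, which could not lower the weight 0 anyway. *)
Lemma cl_unique C l m : cl R C -> l \in C -> m \in C -> l.1 = m.1 -> l = m.
Proof.
move=> /clP[A1 [A2 [b [_ ->]]]]; rewrite !inE => /orP[] /eqP-> /orP[] /eqP-> //=.
  by case: b.
by case: b.
Qed.

Lemma cl_no_neg C : cl R C -> no_neg_splitting C.
Proof.
move=> /clP[A1 [A2 [b [_ ->]]]] q; rewrite !inE; apply/negP => /orP[] /eqP //.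
Qed.

(** A premise ready for resolution on the last atom: the resolvent will retain no literal on it. *)
Definition sole_literal M J b D s l : Prop :=
  [/\ ground_subst s, falsifies (M, rcons J b) s D, no_neg_splitting D, l \in D &
      exists A, [/\ e (size J) = Some A, lsubst s l = (~~ b, inl A)
        & forall m, m \in D -> lsubst s m = (~~ b, inl A) -> m = l]].

(** A clause failing at the child but not at the parent has a literal on the last atom. For a
    lightest one, a negative splitting literal or a second literal on that atom allows an
    improvement. *)
Lemma improvable_or_sole S M J b k : supported S M ->
  (forall k, ~ wfails S (M, J) k) -> wfails S (M, rcons J b) k ->
  improvable S (M, rcons J b) \/
  exists D s l, (S `|` cl R) D /\ sole_literal M J b D s l.
Proof.
move=> supM nJ fJb.
have sole D s : (S `|` cl R) D -> ground_subst s -> falsifies (M, rcons J b) s D ->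
    exists l A, [/\ l \in D, e (size J) = Some A & lsubst s l = (~~ b, inl A)].
  move=> SD gs fD; apply: contrapT => nex.
  have fJ : fails (M, J) D.
    exists s => // l lD; have [//|[A eJ sl]] := lfalse_rcons (fD l lD).
    by case: nex; exists l, A.
  case: SD => [SD|cD]; last by apply: (nJ 0); left; exists D.
  by apply: (nJ (weight D).+1); right; exists D.
have [[D cD [s gs fD]]|[D [SD [s gs fD] Dleast]]] := wfails_least fJb.
  have [|l [A [lD eJ sl]]] := sole D s _ gs fD; first by right.
  right; exists D, s, l; split; first by right.
  split=> //; first exact: cl_no_neg.
  exists A; split=> // m mD sm; apply: cl_unique cD mD lD _.
  by move: (congr1 fst sm) (congr1 fst sl) => /= -> ->.
have SD' : (S `|` cl R) D by left.
have [[q qD]|nneg] := pselect (exists q, (false, inr q) \in D).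
  have [|E [inf fE ED]] := resolve_splitting (J := rcons J b) supM SD' _ qD; first by exists s.
  by left; apply: improvable_lt ED.
have [l [A [lD eJ sl]]] := sole D s SD' gs fD.
have [[m [mD ml sm]]|uniq] :=
    pselect (exists m, [/\ m \in D, m != l & lsubst s m = (~~ b, inl A)]).
  have [E [inf fE ED]] := factor_step SD' gs fD eJ lD mD ml sl sm.
  by left; apply: improvable_lt ED.
right; exists D, s, l; split=> //; split=> //.
  by move=> q; apply/negP => qD; apply: nneg; exists q.
exists A; split=> // m mD sm; apply: contrapT => /eqP ml.
by apply: uniq; exists m.
Qed.

(** The clauses failing at the two children resolve to one failing at the parent. As the parent had
    infinite weight, this is progress however heavy the resolvent. *)
Lemma inference_node S M J : supported S M ->
  (forall k, ~ wfails S (M, J) k) -> (forall b, exists k, wfails S (M, rcons J b) k) ->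
  improvable S (M, J) \/ exists b, improvable S (M, rcons J b).
Proof.
move=> supM nJ fJ.
have [k0 /(improvable_or_sole supM nJ)[?|]] := fJ false; first by right; exists false.
have [k1 /(improvable_or_sole supM nJ)[?|]] := fJ true; first by right; exists true.
(* [D2] belongs to the child where the last atom is true, and so is the negative premise. *)
move=> [D2 [s2 [l2 [SD2 [gs2 fD2 nn2 l2D [A [eJ sl2 uniq2]]]]]]].
move=> [D1 [s1 [l1 [SD1 [gs1 fD1 nn1 l1D [A' [eJ' sl1 uniq1]]]]]]].
have AA' : A' = A by move: eJ'; rewrite eJ => -[].
rewrite {}AA' in sl1 uniq1.
have [r [t [ren disj gt tD1 tD2]]] := rename_apart D1 D2 gs1 gs2.
have {}fD1 : falsifies (M, rcons J false) t D1 by move=> l lD; rewrite tD1 //; apply: fD1.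
have fP2 : falsifies (M, rcons J true) t (csubst r D2).
  by move=> _ /csubstP[l lD ->]; rewrite tD2 //; apply: fD2.
have tl1 : lsubst t l1 = (true, inl A) by rewrite tD1.
have tl2 : lsubst t (lsubst r l2) = (false, inl A) by rewrite tD2.
have {}uniq1 m : m \in D1 -> lsubst t m = (true, inl A) -> m = l1.
  by move=> mD; rewrite tD1 //; apply: uniq1.
have {}uniq2 m : m \in csubst r D2 -> lsubst t m = (false, inl A) -> m = lsubst r l2.
  by move=> /csubstP[l lD ->]; rewrite tD2 // => /(uniq2 _ lD)->.
have nnP2 : no_neg_splitting (csubst r D2).
  by move=> q; apply/negP => /csubstP[[c [?|q']] qD [] //] cE; move: (nn2 q'); rewrite cE qD.
have := mem_csubst r l2D; set P2 := csubst r D2 in disj fP2 uniq2 nnP2 *.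
case: (lsubst r l2) tl2 uniq2 => [c2 [B2|//]] tl2 uniq2 p2P.
case: l1 sl1 l1D tl1 uniq1 => [c1 [B1|//]] _ l1D tl1 uniq1.
have max1 := maximal_last fD1 l1D eJ (congr1 snd tl1).
have max2 := maximal_last fP2 p2P eJ (congr1 snd tl2).
case: tl1 tl2 => c1E B1A [c2E B2A]; rewrite {}c1E {}c2E /= in l1D p2P uniq1 uniq2 max1 max2.
have BB : psubst t B1 = psubst t B2 by rewrite B1A.
have [u mgu] := mgu_exists BB; have [d gd dP] := is_mgu_ground mgu gt (congr1 inl BB).
set C1 := (D1 `\ (true, inl B1))%fset; set C2 := (P2 `\ (false, inl B2))%fset.
left; exists (csubst u C1 `|` csubst u C2)%fset; split; last exact: nJ.
  left; exists D1, D2; split=> //.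
  exists (@Var Sg), r, u, C1, C2, (inl B1), (inl B2).
  rewrite csubst_Var !fsetD1K //; split=> //.
  + by split=> //; apply: renaming_Var.
  + by split=> // q; apply/negP; rewrite inE => /andP[_]; apply/negP/nn1.
  + by right; split=> // q; apply/negP; rewrite inE => /andP[_]; apply/negP/nnP2.
(* By uniqueness of the resolved literals, all remaining ones are false already at the parent. *)
exists d => //; apply: falsifiesU => _ /csubstP[m + ->]; rewrite dP inE => /andP[mB mD].
  have [//|[A2 + tm]] := lfalse_rcons (fD1 m mD); rewrite eJ => -[AA2].
  by move: mB; rewrite inE (uniq1 m mD) ?eqxx // tm AA2.
have [//|[A2 + tm]] := lfalse_rcons (fP2 m mD); rewrite eJ => -[AA2].
by move: mB; rewrite inE (uniq2 m mD) ?eqxx // tm AA2.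
Qed.

Lemma progress S d : ~ S fset0 ->
  (forall x, d <= size x.2 -> exists k, wfails S x k) ->
  exists x, [/\ (x.1 `<=` Q)%fset, size x.2 <= d & improvable S x].
Proof.
move=> S0 fd; have [M [MQ hM supM]] := minimal_hits S0.
pose bad J := exists k, wfails S (M, J) k.
have [badnil|nbad] := pselect (bad [::]); last first.
  have [|J [sJ nJ fJ]] := last_open_node (d := d) _ nbad; first by move=> J /(fd (M, J)).
  have [k Wk||imp] := inference_node supM _ fJ; first by apply: nJ; exists k.
    by exists (M, J); split=> //; apply: ltnW.
  by move: imp => [b imp]; exists (M, rcons J b); rewrite size_rcons.
(* At the root only splitting atoms have values. A lightest failing clause with a negative literal
   can be resolved; a purely positive one is excluded, since [M] hits it. *)
have [k0 Wk0] := badnil; exists (M, [::]); split=> //.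
have nil_splitting D s l : falsifies (M, [::]) s D -> l \in D ->
    exists2 q, q \in Q & l.2 = inr q /\ (q \in M) = ~~ l.1.
  by move=> fD /fD; case: l => c [A [i]|q []] //; exists q.
have [[D /clP[A1 [A2 [b [_ ->]]]] [s _ fD]]|[D [SD [s gs fD] Dleast]]] := wfails_least Wk0.
  by have [|q _ []] := nil_splitting _ _ (b, inl A1) fD; rewrite ?fset1U1.
have SD' : (S `|` cl R) D by left.
have [[q qD]|nneg] := pselect (exists q, (false, inr q) \in D).
  have [|E [inf fE ED]] := resolve_splitting (J := [::]) supM SD' _ qD; first by exists s.
  exact: improvable_lt ED.
have [|q qM qD] := hM D.
  split=> // -[[] a] lD; have [q qQ [/= aq qM]] := nil_splitting _ _ _ fD lD.
    by exists q; rewrite // aq.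
  by case: nneg; exists q; rewrite -aq.
have [q' _ [[<-]]] := nil_splitting _ _ _ fD qD.
by rewrite qM.
Qed.

End Falsification.

(** * Completeness: iterating the progress step *)

Section Refutation.
Variables (Sg : signature) (lt : patom Sg -> patom Sg -> Prop)
  (Q : {fset satom Sg}) (R : set (rule Sg)) (phi : tableau Sg -> tableau Sg).
Implicit Types (S : set (clause Sg)) (T U : tableau Sg).

Local Notation derives := (clos_refl_trans (tableau Sg) (derive lt Q R phi)).

Definition refutable T : Prop := exists2 U, derives T U & closed_tableau U.

(** [derive] applies [phi] to one branch alone, so branches can be refuted independently. *)
Lemma derives_context T1 T2 T U : derives T U -> derives (T1 ++ T ++ T2) (T1 ++ U ++ T2).
Proof.
elim=> [{}T {}U [T3 [S [T4 [V [-> SV ->]]]]]|{}T|T3 T4 T5 _ d1 _ d2].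
- apply: rt_step; exists (T1 ++ T3), S, (T4 ++ T2), V; split=> //; rewrite -!catA //.
- exact: rt_refl.
- exact: rt_trans d1 d2.
Qed.

Lemma closed_cat T U : closed_tableau T -> closed_tableau U -> closed_tableau (T ++ U).
Proof.
move=> cT cU i; rewrite size_cat nth_cat; case: (ltnP i (size T)) => [iT _|Ti iTU]; first exact: (cT i).
by apply: (cU (i - size T)); rewrite ltn_subLR.
Qed.

Lemma refutable_branches T : List.Forall (fun S => refutable [:: S]) T -> refutable T.
Proof.
elim=> [|S {}T [U1 d1 c1] _ [U2 d2 c2]]; first by exists [::] => //; apply: rt_refl.
exists (U1 ++ U2); last exact: closed_cat.
apply: rt_trans (derives_context [::] T d1) _.
by have := derives_context U1 [::] d2; rewrite !cats0.
Qed.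

Variable e : nat -> option (patom Sg).
Hypothesis lt_stable : stable lt.
Hypothesis e_ground : forall i A, e i = Some A -> pground A.
Hypothesis e_onto : forall A, pground A -> exists i, e i = Some A.
Hypothesis e_mono : forall i j A B, e i = Some A -> e j = Some B -> lt A B -> (i < j)%N.
Hypothesis R_ordered : ordered lt R.
Hypothesis phi_strategy : strategy Q R phi.

Lemma refutable_of_depth d S :
  (forall x : node Sg, d <= size x.2 -> exists k, wfails e Q R S x k) -> refutable [:: S].
Proof.
have [X XP] := seqs_upto d.
(* These finitely many nodes include every one that [progress] may return. *)
pose nodes : seq (node Sg) := [seq (M, J) | M <- enum_fset (fpowerset Q), J <- X].
elim/(weight_ind (X := nodes) (W := wfails e Q R)): S => [S x k k'|S IH fd].
  exact: wfails_leq.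
have [S0|S0] := pselect (S fset0).
  by exists [:: S]; [apply: rt_refl|case].
have [x [xQ xd [E [inf fE nW]]]] := progress lt_stable e_mono S0 fd.
pose S' := S `|` cl R `|` [set E].
have S'W : wfails e Q R S' x (weight E).+1 by right; exists E; split=> //; right.
have SS' : refines e Q R S S' by move=> y k; apply: wfails_sub => C SC; left; left.
have : List.Forall (refines e Q R S') (phi [:: S']).
  apply: (strategy_refines lt_stable e_onto e_mono R_ordered phi_strategy).
  by apply: List.Forall_cons => // y k.
move=> ref; have [|U dU cU] := refutable_branches (T := phi [:: S']).
  apply: List.Forall_impl ref => V S'V; apply: IH => [y k /SS'/S'V //||y /fd[k /SS'/S'V]].
    exists x, (weight E).+1; split=> //; last exact: S'V.
    case: x xQ xd {fE nW S'W} => M J /= MQ Jd.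
    by apply: allpairs_f; [rewrite fpowersetE|apply: XP].
  by exists k.
exists U => //; apply: rt_trans dU; apply: rt_step.
exists [::], S, [::], (phi [:: S']); split=> //; last by rewrite cats0.
by exists S' => //; exists E.
Qed.

(** A path without failure would be a Herbrand model, so the fan theorem bounds the depth. *)
Lemma unsat_depth (S0 : set (pclause Sg)) :
  ~ satisfiable ((@clause_of Sg @` S0) `|` cl R) ->
  exists d, forall x : node Sg, d <= size x.2 ->
    exists k, wfails e Q R (@clause_of Sg @` S0) x k.
Proof.
move=> unsat; set S := _ @` _ in unsat *.
have ns C l : (S `|` cl R) C -> l \in C -> exists A, l.2 = inl A.
  case=> [[D _ <-]|/clP[A1 [A2 [b [_ ->]]]]]; first exact: clause_ofP.
  by rewrite !inE => /orP[] /eqP->; [exists A1|exists A2].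
(* The set [fset0] is a placeholder: without splitting atoms, failure is the same above every
   [M]. *)
pose bad J := exists2 C, (S `|` cl R) C & fails e Q (fset0, J) C.
have [|f|d badd] := fan_theorem (bad := bad).
- move=> J b [C SC [s gs fC]]; exists C => //; exists s => // l lC.
  have := fC l lC; have [A lA] := ns C l SC lC; rewrite /lfalse /= lA /=.
  move=> [i iJ [ei iv]]; exists i; rewrite /= ?size_rcons; first exact: ltnW.
  by rewrite nth_rcons iJ.
- apply: contrapT => nbad; apply: unsat.
  pose H : set (atom Sg) :=
    [set A | if A is inl A' then exists2 i, e i = Some A' & f i else False].
  exists H.
    by case=> [A|//] x [i /e_ground gA _]; apply: gA.
  move=> C SC; apply/satisfiesP => s gs; apply: contrapT => nl.
  (* The prefix of length [n] gives a value to every atom of the falsified instance. *)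
  have [|n nP] := fset_bound (C := C) (P := fun l i =>
      exists2 A, (lsubst s l).2 = inl A & e i = Some A /\ f i = ~~ l.1).
    move=> l lC; have [A lA] := ns C l SC lC.
    have [i ei] := e_onto (ground_psubst A gs).
    have nh : ~ holds H (lsubst s l) by move=> hl; apply: nl; exists l.
    case: l lC lA nh => -[] a lC /= -> nh.
      exists i, (psubst s A) => //; split=> //; apply/negP => fi.
      by apply: nh; exists i.
    have [j ej fj] := contrapT nh.
    by exists j, (psubst s A).
  apply: nbad; exists n, C => //; exists s => // l /nP[i ni [A lA [ei fi]]].
  rewrite /lfalse lA; exists i; first by rewrite size_mkseq.
  by split=> //; rewrite nth_mkseq.
exists d => -[M J] /= /badd[C SC [s gs fC]].
have {}fC : fails e Q (M, J) C.
  exists s => // l lC; have := fC l lC; have [A lA] := ns C l SC lC.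
  by rewrite /lfalse /= lA.
case: SC => SC; first by exists (weight C).+1; right; exists C.
by exists 0; left; exists C.
Qed.

End Refutation.

Theorem theorem4 (Sg : signature)
  (Hconst : exists c : fsym Sg, farity c = 0)
  (S : set (pclause Sg))
  (lt : patom Sg -> patom Sg -> Prop)
  (R : set (rule Sg))
  (Q : {fset satom Sg})
  (phi : tableau Sg -> tableau Sg) :
  strict_order lt -> stable lt -> enumerable lt ->
  ordered lt R ->
  strategy Q R phi ->
  (~ satisfiable ((@clause_of Sg @` S) `|` cl R) <->
   exists T : tableau Sg,
     clos_refl_trans (tableau Sg) (derive lt Q R phi) [:: @clause_of Sg @` S] T
     /\ closed_tableau T).
Proof.
move=> _ stab [e [gr onto _ mono]] ord strat; split=> [unsat|[T [der clT]]]; last first.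
  exact: derive_unsat Hconst strat der clT.
have [d fd] := unsat_depth Q gr onto unsat.
by have [T der clT] := refutable_of_depth stab onto mono ord strat fd; exists T.
Qed.
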